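(* For every planar graph $G$ there exists a collinear set $X\subset\mathbb{R}^2$ with $|X|=|V(G)|$ such that $\mathrm{fix}(G)=\mathrm{fix}_X(G)$.
   Context: For a planar graph $G$, a drawing of $G$ is an arbitrary injective map $\pi\colon V(G)\to\mathbb{R}^2$, each edge $uv$ being represented by the straight line segment with endpoints $\pi(u),\pi(v)$ (edges may cross or overlap). A plane straight line drawing is a drawing in which these segments are crossing-free, i.e., two edge segments meet only at a common endpoint and no segment contains the image of a vertex other than its endpoints. For a drawing $\pi$, $\mathrm{fix}(G,\pi)=\max_{\pi'}|\{v\in V(G):\pi'(v)=\pi(v)\}|$, the maximum over all plane straight line drawings $\pi'$ of $G$. Define $\mathrm{fix}(G)=\min_\pi \mathrm{fix}(G,\pi)$ over all drawings $\pi$, and for a set $X$ of $|V(G)|$ points in the plane, $\mathrm{fix}_X(G)=\min\{\mathrm{fix}(G,\pi): \pi(V(G))=X\}$. A set $X$ is collinear if it lies on a line. *)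

(* Defs.v *)
From mathcomp Require Import all_boot all_order all_algebra.
From mathcomp Require Import all_classical all_reals all_analysis.

Set Implicit Arguments.
Unset Strict Implicit.
Unset Printing Implicit Defensive.

Import Order.TTheory GRing.Theory Num.Theory.
Import numFieldNormedType.Exports.

Local Open Scope classical_set_scope.
Local Open Scope ring_scope.

(* A finite simple graph is a symmetric irreflexive relation [e] on a finType
   [V]; symmetry and irreflexivity are hypotheses where they are needed. *)

Definition segment (R : realType) (a b : R * R) : set (R * R) :=
  [set p | exists2 t : R, 0 <= t <= 1 &
     p = ((1 - t) * a.1 + t * b.1, (1 - t) * a.2 + t * b.2)].

Definition is_arc (R : realType) (a b : R * R) (A : set (R * R)) : Prop :=
  exists g : R -> R * R,
    [/\ {within `[0, 1], continuous g},
        {in `[0, 1] &, injective g},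
        g 0 = a, g 1 = b & A = g @` `[0, 1]].

Definition same_edge (V : finType) (u v x y : V) : Prop :=
  (u = x /\ v = y) \/ (u = y /\ v = x).

(* [A u v] is the point set representing the edge uv. *)
Definition crossing_free (R : realType) (V : finType) (e : rel V)
    (pi : V -> R * R) (A : V -> V -> set (R * R)) : Prop :=
  (forall u v w : V, e u v -> A u v (pi w) -> w = u \/ w = v) /\
  (forall u v x y : V, e u v -> e x y -> ~ same_edge u v x y ->
     forall p, A u v p -> A x y p ->
       exists w : V, [/\ w = u \/ w = v, w = x \/ w = y & p = pi w]).

(* Planarity in the topological sense: edges are drawn as arbitrary simple
   arcs, not necessarily straight. *)
Definition planar (R : realType) (V : finType) (e : rel V) : Prop :=
  exists (pi : V -> R * R) (A : V -> V -> set (R * R)),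
    [/\ injective pi,
        forall u v, e u v -> A u v = A v u,
        forall u v, e u v -> is_arc (pi u) (pi v) (A u v) &
        crossing_free e pi A].

Definition drawing (R : realType) (V : finType) (pi : V -> R * R) : Prop :=
  injective pi.

Definition plane_drawing (R : realType) (V : finType) (e : rel V)
    (pi : V -> R * R) : Prop :=
  drawing pi /\ crossing_free e pi (fun u v => segment (pi u) (pi v)).

Definition num_fixed (R : realType) (V : finType) (pi pi' : V -> R * R) : nat :=
  #|[pred v | pi' v == pi v]|.

(* The set of attained values is nonempty for a planar graph, by Fary's
   theorem; on a non-planar graph [fix_drawing] is 0. *)
Definition fix_drawing (R : realType) (V : finType) (e : rel V)
    (pi : V -> R * R) : nat :=
  (\max_(k < #|V|.+1 |
      `[< exists2 pi', plane_drawing e pi' & num_fixed pi pi' = k >]) k)%N.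

(* All values of [fix_drawing] are at most #|V|, so using #|V| as the starting
   value of the minimum does not affect it when some drawing satisfies [P]. *)
Definition min_fix (R : realType) (V : finType) (e : rel V)
    (P : (V -> R * R) -> Prop) : nat :=
  (\big[minn/#|V|]_(k < #|V|.+1 |
      `[< exists pi, [/\ drawing pi, P pi & fix_drawing e pi = k] >]) k)%N.

Definition fix_graph (R : realType) (V : finType) (e : rel V) : nat :=
  @min_fix R V e (fun=> True).

Definition fix_on (R : realType) (V : finType) (e : rel V)
    (X : set (R * R)) : nat :=
  @min_fix R V e (fun pi => range pi = X).

Definition collinear (R : realType) (X : set (R * R)) : Prop :=
  exists a d : R * R, d <> (0, 0) /\
    X `<=` [set p | exists t : R, p = (a.1 + t * d.1, a.2 + t * d.2)].

(* Main.v *)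
(** Let [pi] be a drawing attaining fix(G), and compress the plane towards a
    line on which [pi] projects injectively.  Each compressed drawing [pi_x] is
    an affine image of [pi], so fix(G, pi_x) = fix(G, pi), and [pi_x] tends to a
    collinear drawing [pi0] as [x] tends to 0.  Being plane is an open condition
    on the positions of the vertices: in a plane drawing that fixes k vertices
    of [pi0], those vertices can be moved to their positions in [pi_x], for
    small [x], without creating crossings.  Hence
    fix(G, pi0) <= fix(G, pi_x) = fix(G), and X is the image of [pi0]. *)

Require Import Defs.
From mathcomp Require Import all_boot all_order all_algebra.
From mathcomp Require Import all_classical all_reals all_analysis.
From mathcomp Require Import ring lra.

Import Order.TTheory GRing.Theory Num.Theory.
Import numFieldNormedType.Exports.

Local Open Scope classical_set_scope.
Local Open Scope card_scope.
Local Open Scope ring_scope.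

(** * Segments: shared endpoints and stability of disjointness *)

Section SegmentTheory.
Context {R : realType}.
Implicit Types (a b c d p q : R * R) (s t : R).

Lemma segmentE a b p :
  segment a b p <-> exists2 t, 0 <= t <= 1 & p = (1 - t) *: a + t *: b.
Proof. by split=> -[t t01 ->]; exists t. Qed.

Lemma segmentC a b : segment a b = segment b a.
Proof.
suff sub c d : segment c d `<=` segment d c by apply/seteqP; split; exact: sub.
by move=> _ [t t01 ->]; exists (1 - t); [lra | congr pair; ring].
Qed.

Lemma segment_left a b : segment a b a.
Proof. by exists 0; [lra | case: a => ? ?; congr pair => /=; ring]. Qed.

Lemma segmentxx a p : segment a a p <-> p = a.
Proof.
split=> [[t _ ->]|->]; last exact: segment_left.
by case: a => ? ?; congr pair => /=; ring.
Qed.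

(** Let p have parameter s on ab and t on ac, with s <= t after possibly exchanging b and c. If t >
    0, then c = a + (s/t)(b - a) lies on ab, which is excluded; hence t = 0. *)
Lemma segment_common_endpoint a b c p :
  ~ segment a c b -> ~ segment a b c -> segment a b p -> segment a c p -> p = a.
Proof.
suff shorter b' c' s t : 0 <= s <= t -> t <= 1 -> ~ segment a b' c' ->
    p = (1 - s) *: a + s *: b' -> p = (1 - t) *: a + t *: c' -> p = a.
  move=> nb nc /segmentE[s s01 ps] /segmentE[t t01 pt].
  have [st|/ltW ts] := leP s t.
    by apply: (shorter b c s t) => //; lra.
  by apply: (shorter c b t s) => //; lra.
move=> st t1 nc -> eq_p; have [t0|t_gt0] := leP t 0.
  by (have -> : s = 0 by lra); rewrite subr0 scale1r scale0r addr0.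
case: nc; apply/segmentE; exists (s / t).
  by rewrite divr_ge0 ?ler_pdivrMr ?mul1r; lra.
have t_neq0 : t != 0 by rewrite gt_eqF.
case: a b' c' eq_p => [a1 a2] [b1 b2] [c1 c2] /= [e1 e2].
have eqc (x y z : R) : (1 - s) * x + s * y = (1 - t) * x + t * z ->
    z = (1 - s / t) * x + s / t * y.
  move=> E; apply: (mulfI t_neq0).
  have -> : t * ((1 - s / t) * x + s / t * y) = (t - s) * x + s * y by field.
  by lra.
by congr pair; exact: eqc.
Qed.

(* By compactness of the parameter square. *)
Lemma segment_disjoint_near (a b c d : R -> R * R) :
  {for 0, continuous a} -> {for 0, continuous b} ->
  {for 0, continuous c} -> {for 0, continuous d} ->
  segment (a 0) (b 0) `&` segment (c 0) (d 0) = set0 ->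
  \forall x \near (0 : R), segment (a x) (b x) `&` segment (c x) (d x) = set0.
Proof.
move=> ca cb cc cd dis0.
(* The two segments at [x] are disjoint exactly when [D x] has no zero on the unit square. *)
pose D (x : R) (st : R * R) : R * R :=
  ((1 - st.1) *: a x + st.1 *: b x) - ((1 - st.2) *: c x + st.2 *: d x).
have cD (st : R * R) : D z.2 z.1 @[z --> (st, 0 : R)] --> D 0 st.
  have cst : z.1 @[z --> (st, 0 : R)] --> st by exact: cvg_fst.
  have c0 : z.2 @[z --> (st, 0 : R)] --> (0 : R) by exact: cvg_snd.
  have cs : z.1.1 @[z --> (st, 0 : R)] --> st.1.
    by apply: cvg_comp cst _; exact: cvg_fst.
  have ct : z.1.2 @[z --> (st, 0 : R)] --> st.2.
    by apply: cvg_comp cst _; exact: cvg_snd.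
  have cvg2 (f : R -> R * R) : {for 0, continuous f} ->
      f z.2 @[z --> (st, 0 : R)] --> f 0 by move=> cf; exact: cvg_comp c0 cf.
  have cvg1B (f : (R * R) * R -> R) l : f z @[z --> (st, 0 : R)] --> l ->
      (1 - f z) @[z --> (st, 0 : R)] --> 1 - l.
    by move=> cf; apply: cvgB => //; exact: cvg_cst.
  by apply: cvgB; apply: cvgD; apply: cvgZ; auto.
have cpt : compact (`[0, 1] `*` `[0, 1] : set (R * R)).
  by apply: compact_setX; exact: segment_compact.
have : \forall x \near (0 : R),
    `[0, 1] `*` `[0, 1] `<=` [set st | D x st != 0].
  move/compact_near_coveringP: cpt => /(_ R (nbhs (0 : R)) (fun x st => D x st != 0)).
  apply=> -[s t] /= [].
  rewrite !in_itv/= => s01 t01.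
  have D0 : D 0 (s, t) != 0.
    apply/eqP => /subr0_eq E.
    suff : set0 ((1 - s) *: a 0 + s *: b 0) by [].
    rewrite -dis0; split; apply/segmentE; first by exists s.
    by exists t.
  exact: (cvgr_neq0 _ (cD (s, t))).
apply: filterS => x nD; rewrite -subset0 => p.
move=> [/segmentE[s s01 ps] /segmentE[t t01 pt]].
have /= := nD (s, t); rewrite !in_itv/= => /(_ (conj s01 t01)) /eqP; apply.
by rewrite /D/= -ps -pt subrr.
Qed.
End SegmentTheory.

(** * Planarity of drawings under perturbations and linear maps *)

Section PlaneDrawings.
Context {R : realType} {V : finType}.
Implicit Types (e : rel V) (pi rho : V -> R * R).

(* Vertices and edges are treated alike: [u = v] encodes the single vertex u,
   whose segment degenerates to a point. *)
Definition separated e (u v x y : V) : bool :=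
  [&& (u == v) || e u v, (x == y) || e x y, u != x, u != y, v != x & v != y].

(** Reduces planarity to finitely many disjointness conditions, each stable under small
    perturbations. If two edges share an endpoint, neither contains the far end of the other, and
    this already forces them to meet only at the shared vertex. *)
Lemma plane_drawingP e rho : symmetric e -> irreflexive e ->
  plane_drawing e rho <->
  forall u v x y, separated e u v x y ->
    segment (rho u) (rho v) `&` segment (rho x) (rho y) = set0.
Proof.
move=> e_sym e_irr; split.
  move=> [rho_inj [no_vertex no_crossing]] u v x y.
  case/and5P=> uv xy ux uy /andP[vx vy]; rewrite -subset0 => p [].
  have neq w z : w != z -> w <> z by move/eqP.
  case/orP: uv => [/eqP uv|uv]; case/orP: xy => [/eqP xy|xy].
  - by subst v y => /segmentxx -> /segmentxx /rho_inj/neq; apply.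
  - by subst v => /segmentxx -> /(no_vertex _ _ _ xy)[]; exact: neq.
  - subst y => uvp /segmentxx E; subst p.
    case: (no_vertex _ _ _ uv uvp) => E; subst x.
      by rewrite eqxx in ux.
    by rewrite eqxx in vx.
  - move=> uvp xyp.
    have [|w [wuv wxy _]] := no_crossing u v x y uv xy _ p uvp xyp.
      by case=> -[] E _; subst u; [rewrite eqxx in ux | rewrite eqxx in uy].
    by case: wuv wxy => -> []; exact: neq.
move=> dis.
have disF u v x y p : separated e u v x y ->
    segment (rho u) (rho v) p -> segment (rho x) (rho y) p -> False.
  by move=> /dis E uvp xyp; have : set0 p by rewrite -E.
have no_vertex u v w : e u v -> w <> u -> w <> v ->
    ~ segment (rho u) (rho v) (rho w).
  move=> uv /eqP wu /eqP wv; apply: (disF w w u v); last exact: segment_left.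
  by rewrite /separated eqxx uv orbT wu wv.
have common_end a b c p : e a b -> e a c -> b <> c ->
    segment (rho a) (rho b) p -> segment (rho a) (rho c) p -> p = rho a.
  move=> ab ac bc; have irr w z : e w z -> z <> w.
    by move=> + E; rewrite E e_irr.
  apply: segment_common_endpoint; apply: no_vertex => //; try exact: irr.
  by move=> /esym.
split=> [u v E|]; first apply: contrapT => /eqP uv.
  apply: (disF u u v v (rho u)); last by rewrite E; exact: segment_left.
    by rewrite /separated !eqxx uv.
  exact: segment_left.
split=> [u v w uv uvw|u v x y uv xy nsame p].
  apply: contrapT => /not_orP[wu wv]; exact: no_vertex uvw.
(* There are four ways to share an endpoint; segments are reversed where necessary so that both
   start at it. *)
have [E|ux] := eqVneq u x.
  subst x => up xp; exists u; split; [by left|by left|].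
  by apply: (common_end u v y) => // E; apply: nsame; left.
have [E|uy] := eqVneq u y.
  subst y; rewrite (segmentC (rho x)) => up xp.
  exists u; split; [by left|by right|].
  by apply: (common_end u v x) => //;
    [rewrite e_sym | move=> E; apply: nsame; right].
have [E|vx] := eqVneq v x.
  subst x; rewrite (segmentC (rho u)) => up xp.
  exists v; split; [by right|by left|].
  by apply: (common_end v u y) => //;
    [rewrite e_sym | move=> E; apply: nsame; right].
have [E|vy] := eqVneq v y.
  subst y; rewrite segmentC (segmentC (rho x)) => up xp.
  exists v; split; [by right|by right|].
  by apply: (common_end v u x); rewrite ?(e_sym v)// => E; apply: nsame; left.
move=> uvp xyp; case: (disF u v x y p) => //.
by rewrite /separated uv xy ux uy vx vy !orbT.
Qed.

(** Each separated quadruple of vertices gives a neighbourhood of 0, and there are finitely many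
    quadruples. *)
Lemma plane_drawing_near e rho (m : V -> R * R) :
  symmetric e -> irreflexive e ->
  plane_drawing e rho ->
  \forall x \near (0 : R), plane_drawing e (fun v => rho v + x *: m v).
Proof.
move=> e_sym e_irr /(plane_drawingP e rho e_sym e_irr) dis.
pose P (q : V * V * V * V) (t : R) :=
  let: (u, v, x, y) := q in separated e u v x y ->
  segment (rho u + t *: m u) (rho v + t *: m v) `&`
  segment (rho x + t *: m x) (rho y + t *: m y) = set0.
have : \forall t \near (0 : R), forall q, P q t.
  apply: (@filter_forall R _ P (nbhs (0 : R)) _) => -[[[u v] x] y].
  have [sep|nsep] := boolP (separated e u v x y); last first.
    by apply: nearW => t; rewrite /P (negPf nsep).
  have cm w : {for 0, continuous (fun t : R => rho w + t *: m w)}.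
    apply: cvgD; first exact: cvg_cst.
    by apply: cvgZ; [exact: cvg_id | exact: cvg_cst].
  have := segment_disjoint_near _ _ _ _ (cm u) (cm v) (cm x) (cm y).
  rewrite !scale0r !addr0 => /(_ (dis _ _ _ _ sep)).
  by apply: filterS => t dis_t; rewrite /P => _.
apply: filterS => t dis_t; apply/plane_drawingP => // u v x y.
exact: (dis_t (u, v, x, y)).
Qed.

(** An invertible linear map preserves segments and incidences. This one will undo the compression
    towards a line. *)
Lemma plane_drawing_shear e rho (k l : R) : l != 0 ->
  plane_drawing e rho ->
  plane_drawing e (fun v => ((rho v).1 + k * (rho v).2, l * (rho v).2)).
Proof.
move=> l_neq0; pose L (p : R * R) : R * R := (p.1 + k * p.2, l * p.2).
have L_inj : injective L.
  move=> [a b] [c d] [] /= + /(mulfI l_neq0) E; rewrite E.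
  by move=> /addIr ->.
have segL a b p : segment (L a) (L b) p -> exists2 q, segment a b q & p = L q.
  move=> [t t01 ->]; exists ((1 - t) *: a + t *: b); first by exists t.
  rewrite /L /=; congr pair; rewrite /GRing.scale/=; ring.
move=> [rho_inj [no_vertex no_crossing]]; split.
  by move=> u v /L_inj/rho_inj.
split=> [u v w uv /segL[q uvq /L_inj E]|u v x y uv xy nsame r].
  by apply: (no_vertex _ _ _ uv); rewrite E.
move=> /segL[p uvp ->] /segL[q xyq /L_inj E]; subst q.
have [w [wuv wxy ->]] := no_crossing _ _ _ _ uv xy nsame _ uvp xyq.
by exists w; split.
Qed.

(** * The maximum and minimum defining the fix parameters *)

Lemma fix_drawing_le_card e pi : (fix_drawing e pi <= #|V|)%N.
Proof. by apply/bigmax_leqP => k _; rewrite -ltnS. Qed.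

Lemma num_fixed_le_fix_drawing e pi rho :
  plane_drawing e rho -> (num_fixed pi rho <= fix_drawing e pi)%N.
Proof.
move=> plane_rho; have lt_card : (num_fixed pi rho < #|V|.+1)%N.
  by rewrite ltnS max_card.
apply: (bigop.bigmax_sup (Ordinal lt_card)) => //=.
by apply/asboolP; exists rho.
Qed.

Lemma fix_drawing_leP e pi n :
  (forall rho, plane_drawing e rho -> (num_fixed pi rho <= n)%N) ->
  (fix_drawing e pi <= n)%N.
Proof.
by move=> le_n; apply/bigmax_leqP => k /asboolP[rho ? <-]; exact: le_n.
Qed.

Lemma min_fix_le e (P : (V -> R * R) -> Prop) pi :
  drawing pi -> P pi -> (min_fix e P <= fix_drawing e pi)%N.
Proof.
move=> pi_inj Ppi; have lt_card : (fix_drawing e pi < #|V|.+1)%N.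
  by rewrite ltnS fix_drawing_le_card.
rewrite /min_fix -minEnat.
apply: (@bigmin_le_cond _ nat _ #|V| (Ordinal lt_card) _ (@nat_of_ord _)) => /=.
by apply/asboolP; exists pi.
Qed.

Lemma min_fix_attained e (P : (V -> R * R) -> Prop) :
  (exists2 pi, drawing pi & P pi) ->
  exists pi, [/\ drawing pi, P pi & fix_drawing e pi = min_fix e P].
Proof.
move=> [pi0 pi0_inj Ppi0].
have : min_fix e P = #|V| \/
    exists pi, [/\ drawing pi, P pi & fix_drawing e pi = min_fix e P].
  rewrite {2}/min_fix; rewrite {1}/min_fix.
  apply: (big_ind (fun n => n = #|V| \/
    exists pi, [/\ drawing pi, P pi & fix_drawing e pi = n])); first by left.
    by move=> m n Km Kn; rewrite /minn; case: ifP.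
  by move=> k /asboolP ?; right.
(* If the minimum equals its starting value [#|V|], any admissible drawing attains it, since its own
   value lies between the minimum and [#|V|]. *)
case=> // min_card; exists pi0; split => //; apply/eqP.
by rewrite eqn_leq min_fix_le// min_card fix_drawing_le_card.
Qed.

(** * Projection of a drawing to a line *)

Lemma drawing_generic_projection pi : drawing pi ->
  exists c : R, injective (fun v => (pi v).1 + c * (pi v).2).
Proof.
move=> pi_inj.
pose P (q : V * V) (c : R) := q.1 != q.2 ->
  (pi q.1).1 + c * (pi q.1).2 != (pi q.2).1 + c * (pi q.2).2.
(* Each pair of distinct vertices excludes at most one slope [c], so every large [c] works for all
   pairs. *)
have : \forall c \near +oo, forall q, P q c.
  apply: (@filter_forall R _ P (pinfty_nbhs R) _) => -[u v]; rewrite /P /=.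
  have [_|uv] := eqVneq u v; first exact: nearW.
  pose x := (pi u).1 - (pi v).1; pose y := (pi v).2 - (pi u).2.
  near=> c => _; apply/eqP => E.
  have Exy : x = c * y by rewrite /x /y; lra.
  have [y0|y_neq0] := eqVneq y 0.
    move/eqP: uv; apply; apply: pi_inj; rewrite [LHS]surjective_pairing.
    move: Exy; rewrite y0 mulr0 => /subr0_eq ->; move/subr0_eq: y0 => <-.
    by rewrite -surjective_pairing.
  have : x / y < c by near: c; apply: nbhs_pinfty_gt; exact: num_real.
  by rewrite Exy mulfK// ltxx.
move=> /filter_ex[c sep]; exists c => u v E; apply: contrapT => /eqP uv.
by have /eqP := sep (u, v) uv; apply.
Unshelve. all: by end_near.
Qed.

Lemma fix_drawing_projection e pi (c : R) :
  symmetric e -> irreflexive e ->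
  (fix_drawing e (fun v => ((pi v).1 + c * (pi v).2, 0)%R) <=
   fix_drawing e pi)%N.
Proof.
move=> e_sym e_irr; apply: fix_drawing_leP => rho plane_rho.
set pi0 := fun v => _.
(* Only the fixed vertices move: each is lifted to its place in the compressed copy of [pi], whose
   heights are scaled by [x]. *)
pose m v : R * R := if rho v == pi0 v then (0, (pi v).2) else 0.
have near_plane :
    \forall x \near (0 : R)^', plane_drawing e (fun v => rho v + x *: m v).
  exact: nbhs_dnbhs (plane_drawing_near e rho m e_sym e_irr plane_rho).
have [x [plane_x x_neq0]] :=
  filter_ex (filterI near_plane (nbhs_dnbhs_neq (0 : R))).
have xV_neq0 : x^-1 != 0 by rewrite invr_eq0.
(* The shear sends (p1 + c p2, x p2) back to (p1, p2), so every vertex that [rho] fixes returns to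
   its position in [pi]. *)
apply: leq_trans (num_fixed_le_fix_drawing e pi _
  (plane_drawing_shear e _ (- (c / x)) _ xV_neq0 plane_x)).
apply/subset_leq_card/fintype.subsetP => v; rewrite !inE => fix_v.
rewrite /m fix_v (eqP fix_v) /pi0 /= add0r /GRing.scale/= mulr0 addr0.
rewrite mulKf// mulNr -mulrA mulKf// addrK.
by rewrite -surjective_pairing.
Qed.

Lemma card_range_drawing pi : drawing pi -> range pi #= `I_#|V|.
Proof.
move=> pi_inj; apply: (card_eq_trans (B := [set: V])).
  by apply: inj_card_eq => u v _ _; exact: pi_inj.
have <- : (fun v => enum_rank v : nat) @` [set: V] = `I_#|V|.
  apply/seteqP; split=> [_ [v _ <-]|k /= kV]; first exact: ltn_ord.
  by exists (enum_val (Ordinal kV)); rewrite // enum_valK.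
rewrite card_eq_sym; apply: inj_card_eq => u v _ _ /val_inj.
exact: enum_rank_inj.
Qed.

End PlaneDrawings.

Theorem theorem2p1 (R : realType) (V : finType) (e : rel V)
  (e_sym : symmetric e) (e_irr : irreflexive e) (e_planar : planar R e) :
  exists X : set (R * R),
    [/\ collinear X, X #= `I_#|V| & fix_graph R e = fix_on e X].
Proof.
(* The vertex placement of a planar embedding is a drawing, so the minimum fix(G) is attained. *)
have [pi1 [_ [pi1_inj _ _ _]]] := e_planar.
have [|pi [pi_inj _ fix_pi]] := @min_fix_attained R V e (fun=> True).
  by exists pi1.
have [c proj_inj] := drawing_generic_projection pi pi_inj.
pose pi0 v : R * R := ((pi v).1 + c * (pi v).2, 0).
have pi0_inj : drawing pi0 by move=> u v [] /proj_inj.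
exists (range pi0); split.
- exists (0, 0), (1, 0); split=> [[/eqP]|_ [v _ <-]].
    by rewrite oner_eq0.
  by exists (pi0 v).1; rewrite /pi0 /= mulr1 mulr0 !add0r.
- exact: card_range_drawing.
- rewrite /fix_graph /fix_on; apply/eqP; rewrite eqn_leq; apply/andP; split.
    (* Restricting the minimum to drawings onto X can only increase it. *)
    have [|rho [rho_inj _ <-]] :=
        @min_fix_attained R V e (fun rho => range rho = range pi0).
      by exists pi0.
    exact: min_fix_le.
  (* Conversely, [pi0] competes in the minimum over X, and its value is at most that of the optimal
     [pi]. *)
  rewrite -fix_pi.
  apply: leq_trans (fix_drawing_projection e pi c e_sym e_irr).
  exact: min_fix_le.
Qed.
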